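(* Let $\kappa$ be a cardinal with $\kappa^{<\kappa}=\kappa$, let $\mathcal L$ be a relational language with $|\mathcal L|<\kappa$, and let $\alpha<\kappa^+$ be a limit ordinal. Then there is no invariant set $\mathcal K\subseteq\mathrm{Mod}^\kappa_{\mathcal L}$ for which $\cong^\kappa_{\mathcal K}$ is a true $\boldsymbol\Sigma^0_\alpha$ set (in $\mathcal K\times\mathcal K$).
   Context: ${}^\kappa\kappa$ has the bounded topology generated by $N_p=\{x:p\subseteq x\}$, $p\in{}^{<\kappa}\kappa$. For $X$ homeomorphic to a subspace of ${}^\kappa\kappa$: $\boldsymbol\Sigma^0_1(X)$ open, $\boldsymbol\Pi^0_1(X)$ closed, for $\alpha\ge2$ $\boldsymbol\Sigma^0_\alpha(X)$ = unions of $\kappa$ many sets from $\bigcup_{1\le\beta<\alpha}\boldsymbol\Pi^0_\beta(X)$, $\boldsymbol\Pi^0_\alpha(X)$ = complements, $\boldsymbol\Delta^0_\alpha=\boldsymbol\Sigma^0_\alpha\cap\boldsymbol\Pi^0_\alpha$. A set is a true $\boldsymbol\Sigma^0_\alpha$ set if it is in $\boldsymbol\Sigma^0_\alpha$ but in no class of the form $\boldsymbol\Sigma^0_\beta,\boldsymbol\Pi^0_\beta,\boldsymbol\Delta^0_\beta$ properly contained in $\boldsymbol\Sigma^0_\alpha$ (equivalently, it is in $\boldsymbol\Sigma^0_\alpha\setminus\boldsymbol\Pi^0_\alpha$). $\mathrm{Mod}^\kappa_{\mathcal L}$ = $\mathcal L$-structures with domain $\kappa$, topology generated by $N_{\mathcal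 Q}=\{\mathcal M:\mathcal Q$ substructure of $\mathcal M\}$ for $\mathcal Q$ an $\mathcal L$-structure with domain bounded in $\kappa$. Invariant set = closed under isomorphism; $\cong^\kappa_{\mathcal K}$ = isomorphism relation on $\mathcal K$, as a subset of $\mathcal K\times\mathcal K$ with the relative topology. *)

(* Defs.v *)
From HB Require Import structures.
From mathcomp Require Import all_boot all_order.
From mathcomp Require Import all_classical wochoice topology.

Set Implicit Arguments.
Unset Strict Implicit.
Unset Printing Implicit Defensive.

Import Order.TTheory.
Local Open Scope classical_set_scope.
Local Open Scope card_scope.
Local Open Scope order_scope.

Definition card_lt (T U : Type) (A : set T) (B : set U) :=
  A #<= B /\ ~ (B #<= A).

(* A cardinal kappa is a von Neumann initial ordinal; up to isomorphism this is
   a well-order all of whose proper initial segments have smaller cardinality,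
   and the elements of the order are the ordinals below kappa. *)
Definition infinite_cardinal (d : Order.disp_t) (kappa : orderType d) :=
  [/\ well_order (<=%O : rel kappa),
      forall a : kappa, card_lt [set x : kappa | x < a] [set: kappa]
    & infinite_set [set: kappa]].

(* ^{<kappa}kappa: functions into kappa defined on some ordinal a < kappa. *)
Definition bounded_seq (d : Order.disp_t) (kappa : orderType d) : Type :=
  {a : kappa & {x : kappa | x < a} -> kappa}.

Definition power_lt_eq (d : Order.disp_t) (kappa : orderType d) : Prop :=
  [set: bounded_seq kappa] #= [set: kappa].

Record language := Language { symbol : Type; arity : symbol -> nat }.

Record structure (kappa : Type) (L : language) := Structure {
  interp : forall s : symbol L, set ((arity s).-tuple kappa) }.

Definition isomorphic (kappa : Type) (L : language)
    (M N : structure kappa L) :=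
  exists2 f : kappa -> kappa, bijective f &
    forall (s : symbol L) (t : (arity s).-tuple kappa),
      interp M t <-> interp N (map_tuple f t).

Section Mod_topology.
Context (d : Order.disp_t) (kappa : orderType d) (L : language).

Record bounded_structure := BoundedStructure {
  bdom : set kappa;
  bdom_bounded : exists a : kappa, forall x, bdom x -> x < a;
  bstruct : structure (set_type bdom) L }.

(* N_Q, the set of M having Q as a substructure *)
Definition basic_open (Q : bounded_structure) : set (structure kappa L) :=
  [set M | forall (s : symbol L) (t : (arity s).-tuple (set_type (bdom Q))),
     interp (bstruct Q) t <-> interp M (map_tuple set_val t)].

HB.instance Definition _ := gen_eqMixin (structure kappa L).
HB.instance Definition _ := gen_choiceMixin (structure kappa L).
HB.instance Definition _ := isSubBaseTopological.Build (structure kappa L)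
  (range basic_open) id.

Definition invariant_set (K : set (structure kappa L)) :=
  forall M N, isomorphic M N -> K M -> K N.

Definition iso_rel (K : set (structure kappa L)) :
    set (set_type K * set_type K) :=
  [set p | isomorphic (set_val p.1) (set_val p.2)].

End Mod_topology.

Arguments iso_rel {d kappa L} K.

(* An ordinal is an element b of a well-order W: it stands for the order type
   of {c | c < b}.  In particular the least element of W is the ordinal 0. *)
Section Ordinals.
Context (e : Order.disp_t) (W : orderType e).

Definition ord_ge1 (b : W) := exists c : W, c < b.
Definition ord_ge2 (b : W) := exists2 c : W, ord_ge1 c & c < b.
Definition ord_eq1 (b : W) := ord_ge1 b /\ ~ ord_ge2 b.

Definition limit_ordinal (b : W) :=
  ord_ge1 b /\ forall c, c < b -> exists2 c', c < c' & c' < b.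

Definition lt_succ_card (d : Order.disp_t) (kappa : orderType d) (b : W) : Prop :=
  [set c : W | c < b] #<= [set: kappa].

End Ordinals.

Section Borel_hierarchy.
Context (d : Order.disp_t) (kappa : orderType d).
Context (e : Order.disp_t) (W : orderType e) (X : topologicalType).

(* The premise on ~` F i says that F i is in Pi^0_(c i), see Pi0 below. *)
Inductive Sigma0 : W -> set X -> Prop :=
| Sigma0_open (b : W) (S : set X) : ord_eq1 b -> open S -> Sigma0 b S
| Sigma0_bigcup (b : W) (c : kappa -> W) (F : kappa -> set X) :
    ord_ge2 b ->
    (forall i, ord_ge1 (c i)) -> (forall i, c i < b) ->
    (forall i, Sigma0 (c i) (~` F i)) ->
    Sigma0 b (\bigcup_i F i).

Definition Pi0 (b : W) (S : set X) := Sigma0 b (~` S).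

(* "In no properly smaller class" refers to proper inclusion of the pointclasses
   Sigma^0_b, Pi^0_b, Delta^0_b over all spaces, the largest one properly inside
   Sigma^0_b being Delta^0_b; on an individual X the hierarchy may collapse. *)
Definition true_Sigma0 (b : W) (S : set X) := Sigma0 b S /\ ~ Pi0 b S.

End Borel_hierarchy.

(* Main.v *)
Require Import Defs.
From mathcomp Require Import all_boot all_order.
From mathcomp Require Import finmap all_classical wochoice topology.

(* Sym(kappa) acts continuously on structures, and since kappa is regular with
   kappa^{<kappa} = kappa, the kappa-Baire category theorem holds in Sym(kappa)
   and sets in the Borel hierarchy have the Baire property. Hence the Vaught
   transforms F^{*p} = {(M, N) | for comeagerly many permutations g extending p,
   (M, N.g) in F} stay in the class Pi^0_b of F.
   Write isomorphism on K as the union of F_i in Pi^0_(c_i), c_i < alpha. Then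
   F_i^{*q} only contains isomorphic pairs. By the Baire category theorem
   (M, M) lies in some F_i^{*p}, and if N is isomorphic to M, translating by an
   isomorphism puts (M, N) in F_i^{*q} for some q. So M and N are NOT isomorphic
   iff, for some i and p, (M, M) is in F_i^{*p} and (M, N) is in no F_i^{*q}.
   For fixed i and p this condition is Borel of rank below the limit alpha, so
   the complement of isomorphism is Sigma^0_alpha. *)

Set Implicit Arguments.
Unset Strict Implicit.
Unset Printing Implicit Defensive.

Import Order.TTheory.
Local Open Scope order_scope.
Local Open Scope card_scope.
Local Open Scope classical_set_scope.

(** * Cardinal comparison and well-foundedness *)

Lemma card_leT_inj (T U : Type) (B : set U) : [set: T] #<= B ->
  exists2 f : T -> U, injective f & forall x, B (f x).
Proof.
elim/Ppointed: U => U in B *.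
  rewrite (_ : B = set0) => [/card_le0P T0|]; last first.
    by apply/seteqP; split=> x; case: (no x).
  have nT (x : T) : False by have : [set: T] x by []; rewrite T0.
  by exists (fun x => False_rect _ (nT x)) => x; case: (nT x).
move=> /pcard_leP[f]; exists f => [x y fxy|x].
  by apply: (@inj _ _ _ f) => //; rewrite inE.
exact: (@funS _ _ _ _ f).
Qed.

Lemma well_order_wf (d : Order.disp_t) (T : orderType d) :
  well_order (<=%O : rel T) -> well_founded (fun x y : T => x < y).
Proof.
move=> wo x; apply/not_notP => nx.
pose A := [pred y : T | ~~ `[< Acc (fun x y : T => x < y) y >]].
have AP y : y \in A <-> ~ Acc (fun x y : T => x < y) y.
  by rewrite inE /=; split=> /asboolPn.
have [|z [[/AP zA zmin] _]] := wo A; first by exists x; apply/AP.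
apply: zA; constructor => y yz; apply/not_notP => /AP/zmin.
by rewrite leNgt yz.
Qed.

(** * Regularity of kappa and Baire category in Sym(kappa) *)

Section Cardinal.
Context (d : Order.disp_t) (kappa : orderType d).

(** The form in which size at most kappa is used: unions and intersections over [I] are reindexed by
    kappa along such a surjection. *)
Definition onto (I : Type) := exists e : kappa -> I, forall i, exists k, e k = i.

Lemma inj_onto (I : Type) (i0 : I) (f : I -> kappa) : injective f -> onto I.
Proof.
move=> f_inj.
have /choice[e eP] : forall k, exists i, forall j, f j = k -> i = j.
  move=> k; have [[j fj]|nj] := pselect (exists j, f j = k).
    by exists j => j' fj'; apply: f_inj; rewrite fj fj'.
  by exists i0 => j fj; case: nj; exists j.
by exists e => i; exists (f i); apply: eP.
Qed.

(* Outside the domain of [u] the value [x] is junk. *)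
Definition extend (u : bounded_seq kappa) (x : kappa) : kappa :=
  if pselect (x < projT1 u) is left xu then projT2 u (exist _ x xu) else x.

Definition restrict (a : kappa) (f : kappa -> kappa) : bounded_seq kappa :=
  existT _ a (fun x => f (sval x)).

Lemma extend_restrict a f x : x < a -> extend (restrict a f) x = f x.
Proof. by rewrite /extend; case: pselect. Qed.

Context (kinf : infinite_cardinal kappa) (kpow : power_lt_eq kappa).

Lemma initial_not_onto (a : kappa) (f : kappa -> kappa) :
  exists y, forall x, x < a -> f x <> y.
Proof.
case: kinf => _ /(_ a)[_ na] _; apply/not_existsP => h; apply: na.
have -> : [set: kappa] = f @` [set x | x < a].
  apply/seteqP; split => y // _; have /existsNP[x] := h y.
  by move=> /not_implyP[xa /contrapT fx]; exists x.
exact: card_image_le.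
Qed.

(** If [m] were the largest element, kappa without [m] would still be infinite, and a Hilbert hotel
    shift along a sequence [u] in it would map the segment below [m] onto kappa. *)
Lemma exists_gt (m : kappa) : exists x, m < x.
Proof.
case: kinf => _ _ infk; apply/not_existsP => mmax.
have xm (x : kappa) : x <= m by rewrite leNgt; apply/negP => /(mmax x).
have : infinite_set ([set: kappa] `\ m) by apply: infinite_setD.
move=> /infiniteP/card_leT_inj[u u_inj um].
have /choice[f fP] : forall x, exists y,
    [/\ x = u 0 -> y = m, forall n, x = u n.+1 -> y = u n
      & (forall n, x <> u n) -> y = x].
  move=> x; have [[[|n] ->]|nx] := pselect (exists n, x = u n).
  - by exists m; split=> // [n /u_inj//|/(_ 0)].
  - by exists (u n); split=> [/u_inj//|k /u_inj[->]//|/(_ n.+1)].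
  - by exists x; split=> // [x0|n xn]; case: nx; [exists 0|exists n.+1].
have [y yP] := initial_not_onto m f.
have um_lt n : u n < m.
  by rewrite lt_neqAle xm andbT; apply/eqP; have [] := um n.
have [[n yn]|ny] := pselect (exists n, y = u n).
  by apply: (yP (u n.+1)) => //; have [_ /(_ n erefl) -> _] := fP (u n.+1).
have [ym|ym] := eqVneq y m.
  by apply: (yP (u 0)) => //; rewrite ym; have [/(_ erefl)] := fP (u 0).
apply: (yP y); first by rewrite lt_neqAle ym xm.
by have [_ _] := fP y; apply => n yn; apply: ny; exists n.
Qed.

Lemma kappa_point : inhabited kappa.
Proof.
case: kinf => _ _ infk; apply/not_notP => nk; apply: infk.
rewrite (_ : [set: kappa] = set0); first exact: finite_set0.
by apply/seteqP; split=> x // _; case: nk.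
Qed.

Lemma exists_gt2 (x y : kappa) : exists2 b, x < b & y < b.
Proof.
have [b] := exists_gt (Order.max x y); rewrite gt_max => /andP[xb yb].
by exists b.
Qed.

Lemma bounded_seq_inj : exists f : bounded_seq kappa -> kappa, injective f.
Proof.
move: kpow; rewrite /power_lt_eq card_eq_le => /andP[/card_leT_inj[f f_inj _] _].
by exists f.
Qed.

Lemma onto_bounded_seq : onto (bounded_seq kappa).
Proof.
have [x0] := kappa_point.
have [f f_inj] := bounded_seq_inj.
exact: (inj_onto (restrict x0 id) f_inj).
Qed.

(* A cofinal family [f x], [x < a], would let us diagonalise against an
   enumeration of all functions from [a] to [kappa]. *)
Lemma regular (a : kappa) (f : kappa -> kappa) :
  exists b, forall x, x < a -> f x < b.
Proof.
apply/not_existsP => unb.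
have [E E_onto] := onto_bounded_seq.
have /choice[g gP] : forall x, exists y, forall j, j < f x -> extend (E j) x <> y.
  by move=> x; exact: (initial_not_onto (f x) (fun j => extend (E j) x)).
have [j Ej] := E_onto (restrict a g).
have [b jb] := exists_gt j.
have /existsNP[x /not_implyP[xa /negP]] := unb b; rewrite -leNgt => bf.
by apply: (gP x j); [exact: lt_le_trans bf | rewrite Ej extend_restrict].
Qed.

Lemma two_points : exists x0 x1 : kappa, x0 < x1.
Proof. by have [x0] := kappa_point; have [x1] := exists_gt x0; exists x0, x1. Qed.

(** The two components are stored at the places [x0] and [x1] of one bounded sequence, and bounded
    sequences inject into kappa. *)
Lemma pair_inj : exists f : kappa * kappa -> kappa, injective f.
Proof.
have [x0 [x1 x01]] := two_points; have [b x1b] := exists_gt x1.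
have [f f_inj] := bounded_seq_inj.
pose g (p : kappa * kappa) := restrict b (fun z => if z == x0 then p.1 else p.2).
exists (f \o g); apply: inj_comp => // -[p1 p2] [q1 q2] gpq.
have x0b := lt_trans x01 x1b.
have := congr1 (extend^~ x0) gpq; rewrite !extend_restrict // eqxx /= => ->.
have := congr1 (extend^~ x1) gpq; rewrite !extend_restrict //.
by rewrite gt_eqF //= => ->.
Qed.

Lemma onto_prod (I J : Type) : onto I -> onto J -> onto (I * J).
Proof.
move=> [e eP] [e' e'P]; have [x0] := kappa_point.
have [f /(inj_onto (x0, x0))[c cP]] := pair_inj.
exists (fun k => (e (c k).1, e' (c k).2)) => -[i j].
have [[k <-] [k' <-]] := (eP i, e'P j).
by have [l cl] := cP (k, k'); exists l; rewrite cl.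
Qed.

Lemma onto_id : onto kappa.
Proof. by exists id => k; exists k. Qed.

Lemma onto_bool : onto bool.
Proof.
have [x0 [x1 x01]] := two_points.
by exists (fun x => x == x0) => -[]; [exists x0; rewrite eqxx|exists x1; rewrite gt_eqF].
Qed.

Lemma onto_option (I : Type) : onto I -> onto (option I).
Proof.
move=> [e eP].
have [c cP] := onto_prod onto_bool (ex_intro _ e eP).
exists (fun k => if (c k).1 then Some (c k).2 else None) => -[i|].
  by have [k ck] := cP (true, i); exists k; rewrite ck.
have [x0] := kappa_point.
by have [k ck] := cP (false, e x0); exists k; rewrite ck.
Qed.

(* Forcing conditions: graphs of partial injections whose domain and range are
   bounded in kappa. They index the basic open sets of Sym(kappa). *)
Definition cond (p : set (kappa * kappa)) :=
  (exists a, forall u, p u -> u.1 < a /\ u.2 < a) /\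
  (forall u v, p u -> p v -> u.1 = v.1 <-> u.2 = v.2).

Definition condition := {p : set (kappa * kappa) | cond p}.

Lemma cond0 : cond set0.
Proof. by have [x0] := kappa_point; split=> //; exists x0. Qed.

(** A condition is coded by a bounded sequence with tagged values: [pr (x0, z)] at [x] means that
    [x] goes to [z], and [pr (x1, x0)] that [x] is outside the domain. Sequences that code no
    condition are sent to the empty one. *)
Lemma onto_condition : onto condition.
Proof.
have [x0 [x1 x01]] := two_points.
have [pr pr_inj] := pair_inj.
have [e eP] := onto_bounded_seq.
pose dec u : set (kappa * kappa) :=
  [set z | z.1 < projT1 u /\ extend u z.1 = pr (x0, z.2)].
have decP p : cond p -> exists k, dec (e k) = p.
  move=> [[a pa] pf].
  have /choice[f fP] : forall x, exists y, forall z, y = pr (x0, z) <-> p (x, z).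
    move=> x; have [[z pz]|nz] := pselect (exists z, p (x, z)).
      exists (pr (x0, z)) => z'; split=> [/pr_inj[<-]//|pz'].
      by have [/(_ erefl) /= ->] := pf _ _ pz pz'.
    exists (pr (x1, x0)) => z; split=> [/pr_inj[x10]|pz].
      by move: x01; rewrite x10 ltxx.
    by case: nz; exists z.
  have [k ek] := eP (restrict a f); exists k; rewrite ek.
  apply/seteqP; split=> -[x y] /=.
    by move=> [xa]; rewrite extend_restrict // => /fP.
  move=> pxy; have [/= xa _] := pa _ pxy.
  by split=> //; rewrite extend_restrict //; apply/fP.
pose c0 : condition := exist _ _ cond0.
exists (fun k => if pselect (cond (dec (e k))) is left ck then exist _ _ ck else c0).
move=> [p cp]; have [k dk] := decP p cp; exists k.
have cdk : cond (dec (e k)) by rewrite dk.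
by case: pselect => // c; apply: eq_exist; rewrite dk.
Qed.

Definition extends (h : kappa -> kappa) (p : set (kappa * kappa)) :=
  forall u, p u -> h u.1 = u.2.

Lemma cond_extends h p a : injective h -> extends h p ->
  (forall u, p u -> u.1 < a /\ u.2 < a) -> cond p.
Proof.
move=> h_inj hp pa; split; first by exists a.
move=> u v /hp <- /hp <-; split=> [->//|/h_inj//].
Qed.

Lemma extends_sub h p q : p `<=` q -> extends h q -> extends h p.
Proof. by move=> pq hq u /pq/hq. Qed.

Lemma extends_setU h p q : extends h p -> extends h q -> extends h (p `|` q).
Proof. by move=> hp hq u [/hp|/hq]. Qed.

Lemma cond_setU h p q : injective h -> extends h p -> extends h q ->
  cond p -> cond q -> cond (p `|` q).
Proof.
move=> h_inj hp hq [[a pa] _] [[b qb] _].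
have [c ac bc] := exists_gt2 a b.
apply: (cond_extends (a := c) h_inj (extends_setU hp hq)) => u [/pa|/qb] [u1 u2].
  by split; [exact: lt_trans ac|exact: lt_trans ac].
by split; [exact: lt_trans bc|exact: lt_trans bc].
Qed.

Lemma cond_graph h (a : kappa) : injective h -> cond [set u | u.1 < a /\ h u.1 = u.2].
Proof.
move=> h_inj; have [b hb] := regular a h; have [c ac bc] := exists_gt2 a b.
apply: (cond_extends (a := c) h_inj) => [u []//|u [ua <-]].
by split; [exact: lt_trans ac|exact: lt_trans (hb _ ua) bc].
Qed.

Lemma cond_setU1 p x y : cond p -> (forall u, p u -> u.1 <> x) ->
  (forall u, p u -> u.2 <> y) -> cond (p `|` [set (x, y)]).
Proof.
move=> [[a pa] pf] px py.
have [b ab xb] := exists_gt2 a x; have [c bc yc] := exists_gt2 b y.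
split.
  exists c => u [/pa[u1 u2]|->] /=; last by split=> //; apply: lt_trans bc.
  by split; apply: lt_trans bc; apply: lt_trans ab.
move=> u v [pu|->] [pv|->] //=; first exact: pf.
- by split=> [/(px _ pu)|/(py _ pu)].
- by split=> [/esym/(px _ pv)|/esym/(py _ pv)].
Qed.

Lemma cond_add_dom p x : cond p ->
  exists q, [/\ cond q, p `<=` q & exists y, q (x, y)].
Proof.
move=> cp; have [[y pxy]|nx] := pselect (exists y, p (x, y)).
  by exists p; split=> //; exists y.
have [[a pa] _] := cp.
(* The strict bound [a] of [p] is a fresh value. *)
exists (p `|` [set (x, a)]); split; [|exact: subsetUl|by exists a; right].
apply: cond_setU1 => // [[u v] puv /= ux|u /pa[_ ua] uE].
  by apply: nx; exists v; rewrite -ux.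
by move: ua; rewrite uE ltxx.
Qed.

Lemma cond_add_ran p y : cond p ->
  exists q, [/\ cond q, p `<=` q & exists x, q (x, y)].
Proof.
move=> cp; have [[x pxy]|ny] := pselect (exists x, p (x, y)).
  by exists p; split=> //; exists x.
have [[a pa] _] := cp.
exists (p `|` [set (a, y)]); split; [|exact: subsetUl|by exists a; right].
apply: cond_setU1 => // [u /pa[ua _] uE|[u v] puv /= vy].
  by move: ua; rewrite uE ltxx.
by apply: ny; exists u; rewrite -vy.
Qed.

Definition dense_cond (D : set (set (kappa * kappa))) :=
  forall p, cond p -> exists q, [/\ cond q, p `<=` q & D q].

Definition meets (h : kappa -> kappa) (D : set (set (kappa * kappa))) :=
  exists2 q, cond q & D q /\ extends h q.

(* [A] contains the intersection of kappa many dense open subsets of the basic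
   open set of the permutations extending [p]. *)
Definition comeager (p : set (kappa * kappa)) (A : set (kappa -> kappa)) :=
  exists D : kappa -> set (set (kappa * kappa)), (forall i, dense_cond (D i)) /\
    forall h, bijective h -> extends h p -> (forall i, meets h (D i)) -> A h.

(** Two pairs are compared inside the later of their stages, and regularity bounds the union.
    Adjoining [p] matters for the least [i], which has no earlier stages. *)
Lemma cond_chain (i : kappa) (p : set (kappa * kappa))
    (P : kappa -> set (kappa * kappa)) :
  cond p -> (forall j, j < i -> cond (P j) /\ p `<=` P j) ->
  (forall j k, j <= k -> k < i -> P j `<=` P k) ->
  cond (p `|` [set u | exists2 j, j < i & P j u]).
Proof.
move=> [[a pa] pf] cP PP; split; last first.
  move=> u v [pu|[j ji Pu]] [pv|[k ki Pv]]; first exact: pf.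
  - by have [[_ Pf] pP] := cP k ki; apply: Pf => //; apply: pP.
  - by have [[_ Pf] pP] := cP j ji; apply: Pf => //; apply: pP.
  - have [jk|/ltW kj] := leP j k.
      by have [[_ Pf] _] := cP k ki; apply: Pf => //; apply: PP Pu.
    by have [[_ Pf] _] := cP j ji; apply: Pf => //; apply: PP Pv.
have /choice[f fP] : forall j, exists b, j < i -> forall u, P j u -> u.1 < b /\ u.2 < b.
  move=> j; have [ji|_] := ltP j i; last by exists j.
  by have [[[b Pb] _] _] := cP j ji; exists b.
have [b fb] := regular i f; have [c ac bc] := exists_gt2 a b.
exists c => u [/pa[u1 u2]|[j ji /(fP _ ji)[u1 u2]]].
  by split; apply: lt_trans ac.
by split; apply: lt_trans bc; apply: lt_trans (fb _ ji).
Qed.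

(* Build an increasing kappa-sequence of conditions, meeting the [i]-th dense
   set and deciding [h i] and the preimage of [i] at stage [i]. *)
Lemma comeager_nonempty p A : cond p -> comeager p A ->
  exists h, [/\ bijective h, extends h p & A h].
Proof.
move=> cp [D [D_dense DA]].
pose good i q := [/\ cond q, D i q, exists y, q (i, y) & exists x, q (x, i)].
have /choice[next nextP] : forall ir, exists q, cond ir.2 ->
    good ir.1 q /\ ir.2 `<=` q.
  (* [set0] is a junk value: by [cbase] below, the recursion passes only conditions to [next]. *)
  move=> [i r]; have [cr|] := pselect (cond r); last by exists set0.
  have [q1 [c1 rq1 [y q1y]]] := cond_add_dom i cr.
  have [q2 [c2 q12 [x q2x]]] := cond_add_ran i c1.
  have [q [cq q2q Dq]] := D_dense i _ c2.
  exists q => _; split=> [|u /rq1/q12/q2q//].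
  by split=> //; [exists y; apply/q2q/q12|exists x; apply/q2q].
have wf := well_order_wf (let: And3 wo _ _ := kinf in wo).
pose body i (rec : forall j, j < i -> set (kappa * kappa)) : set (kappa * kappa) :=
  next (i, p `|` [set u | exists j (ji : j < i), rec j ji u]).
pose P := Fix wf (fun _ => set (kappa * kappa)) body.
pose base i := p `|` [set u | exists2 j, j < i & P j u].
have PE i : P i = next (i, base i).
  rewrite /P Fix_eq => [|j f g fg]; last first.
    by congr (body j _); apply: functional_extensionality_dep => k;
      apply: functional_extensionality_dep => kj.
  congr (next (_, _ `|` _)); apply/seteqP; split=> u [j].
    by move=> [ji Pu]; exists j.
  by move=> ji Pu; exists j, ji.
have PP j i : j < i -> cond (base i) -> P j `<=` P i.
  move=> ji /(nextP (i, _))[_ bP] u Pu; rewrite (PE i); apply: bP.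
  by right; exists j.
have cbase i : cond (base i).
  elim/(well_founded_ind wf): i => i IH; apply: cond_chain => // [j ji|j k].
    have [[cj _ _ _] bP] := nextP (j, _) (IH j ji); rewrite PE; split=> // u pu.
    by apply: bP; left.
  by rewrite le_eqVlt => /predU1P[-> _ //|jk ki]; exact: PP (IH k ki).
have goodP i : good i (P i).
  by have [] := nextP (i, _) (cbase i); rewrite PE.
have pP i : p `<=` P i.
  by move=> u pu; rewrite PE; have [_] := nextP (i, _) (cbase i); apply; left.
have PPle j i : j <= i -> P j `<=` P i.
  by rewrite le_eqVlt => /predU1P[->//|ji]; exact: PP.
have Pfun i j u v : P i u -> P j v -> u.1 = v.1 <-> u.2 = v.2.
  move=> Pu Pv; have [[_ Pf] _ _ _] := goodP (Order.max i j).
  by apply: Pf; [apply: PPle Pu|apply: PPle Pv]; rewrite le_max lexx ?orbT.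
have /choice[h hP] : forall x, exists y, P x (x, y) by move=> x; have [] := goodP x.
have /choice[g gP] : forall y, exists x, P y (x, y) by move=> x; have [] := goodP x.
have hext i : extends h (P i).
  by move=> u Pu; have [/(_ erefl)] := Pfun _ _ _ _ (hP u.1) Pu.
have hbij : bijective h.
  exists g => x; last exact: (hext x _ (gP x)).
  by have [_ /(_ erefl)] := Pfun _ _ _ _ (gP (h x)) (hP x).
have [x0] := kappa_point.
exists h; split=> //; first exact: extends_sub (pP x0) (hext x0).
apply: DA => // [|i]; first exact: extends_sub (pP x0) (hext x0).
by have [ci Di _ _] := goodP i; exists (P i).
Qed.

Lemma comeager_sub p A B :
  (forall h, bijective h -> extends h p -> A h -> B h) ->
  comeager p A -> comeager p B.
Proof.
move=> AB [D [D_dense DA]]; exists D; split=> // h hb hp hD.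
exact: AB (DA h hb hp hD).
Qed.

Lemma comeager_ext p q A : p `<=` q -> comeager p A -> comeager q A.
Proof.
move=> pq [D [D_dense DA]]; exists D; split=> // h hb hq hD.
exact: DA hb (extends_sub pq hq) hD.
Qed.

Lemma comeager_bigcap (I : Type) p (A : I -> set (kappa -> kappa)) : onto I ->
  (forall i, comeager p (A i)) -> comeager p (\bigcap_i A i).
Proof.
move=> oI /choice[D DP]; have [c cP] := onto_prod oI onto_id.
exists (fun k => D (c k).1 (c k).2); split=> [k|h hb hp hD i _].
  by have [] := DP (c k).1.
have [_] := DP i; apply=> // j.
by have [k ck] := cP (i, j); have := hD k; rewrite ck.
Qed.

Lemma comeagerT p A : (forall h, bijective h -> extends h p -> A h) -> comeager p A.
Proof.
by move=> pA; exists (fun=> setT); split=> [i q cq|h hb hp _]; [exists q; split|exact: pA].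
Qed.

Lemma comeager_dense p (D : set (set (kappa * kappa))) A : dense_cond D ->
  (forall h, bijective h -> extends h p -> meets h D -> A h) -> comeager p A.
Proof.
move=> D_dense DA; have [x0] := kappa_point.
by exists (fun=> D); split=> // h hb hp /(_ x0); exact: DA.
Qed.

Definition compatible (p q : set (kappa * kappa)) := cond (p `|` q).

(** There are only kappa many conditions [r] on which [A] is comeager. Comeagerly many permutations
    extend one of them, and comeagerly many lie in [A] as soon as they extend any of them. *)
Lemma comeager_local p A : cond p ->
  (forall q, cond q -> p `<=` q ->
    exists r, [/\ cond r, q `<=` r & comeager r A]) -> comeager p A.
Proof.
move=> cp pA.
pose B (o : option condition) : set (kappa -> kappa) :=
  if o is Some r then [set h | comeager (sval r) A -> extends h (sval r) -> A h]
  else [set h | exists r : condition, comeager (sval r) A /\ extends h (sval r)].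
apply: (@comeager_sub _ (\bigcap_o B o)).
  move=> h hb hp hB; have [r [rA hr]] := hB None I.
  exact: (hB (Some r) I).
apply: (comeager_bigcap (onto_option onto_condition)) => -[[r cr]|] /=.
  have [[D [D_dense DA]]|nA] := pselect (comeager r A); last first.
    by apply: comeagerT => h _ _ /nA.
  exists (fun i => [set q | D i q \/ ~ compatible q r]); split.
    move=> i q cq; have [cqr|nqr] := pselect (compatible q r).
      have [s [cs qs Ds]] := D_dense i _ cqr.
      by exists s; split=> //; [exact: subset_trans qs|left].
    by exists q; split=> //; right.
  move=> h hb hp hD _ hr; apply: DA => // i.
  have [q cq [Dq hq]] := hD i; exists q => //; split=> //.
  by case: Dq => // nqr; case: nqr; exact: cond_setU (bij_inj hb) hq hr cq cr.
(* Density concerns all conditions, so those incompatible with [p] are let in; no permutation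
   extending [p] extends one of them. *)
apply: (@comeager_dense _ [set r | comeager r A \/ ~ compatible p r]).
  move=> q cq; have [cpq|npq] := pselect (compatible p q).
    have [r [cr qr rA]] := pA _ cpq (@subsetUl _ _ _).
    by exists r; split=> //; [exact: subset_trans qr|left].
  by exists q; split=> //; right.
move=> h hb hp [r cr [[rA|npr] hr]]; first by exists (exist _ _ cr).
by case: npr; exact: cond_setU (bij_inj hb) hp hr cp cr.
Qed.

Lemma comeager_consistent p q A : cond q -> p `<=` q ->
  comeager q A -> comeager p (~` A) -> False.
Proof.
move=> cq pq qA /(comeager_ext pq) qnA.
have : comeager q (\bigcap_b (if b then A else ~` A)).
  by apply: (comeager_bigcap onto_bool) => -[].
move=> /(comeager_nonempty cq)[h [_ _ hA]].
exact: (hA false I (hA true I)).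
Qed.

(** Local form of differing from an open set by a meager set, the open set being the union of the
    basic open sets on which [A] is comeager. *)
Definition baire_property (A : set (kappa -> kappa)) :=
  forall p, cond p ->
    (exists q, [/\ cond q, p `<=` q & comeager q A]) \/ comeager p (~` A).

(** If the complement is comeager on no extension of [p], then [A] is comeager on some extension of
    each extension of [p], hence on [p] by [comeager_local]. *)
Lemma baire_propertyC A : baire_property A -> baire_property (~` A).
Proof.
move=> bA p cp; rewrite setCK.
have [|nA] := pselect (exists q, [/\ cond q, p `<=` q & comeager q (~` A)]); first by left.
right; apply: comeager_local => // q cq pq.
by have [//|qA] := bA q cq; case: nA; exists q.
Qed.

Lemma baire_property_bigcup (F : kappa -> set (kappa -> kappa)) :
  (forall i, baire_property (F i)) -> baire_property (\bigcup_i F i).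
Proof.
move=> bF p cp; rewrite setC_bigcup.
have [[i [q [cq pq qF]]]|nF] :=
    pselect (exists i q, [/\ cond q, p `<=` q & comeager q (F i)]).
  by left; exists q; split=> //; apply: comeager_sub qF => h _ _ Fh; exists i.
right; apply: (comeager_bigcap onto_id) => i.
by have [[q qF]|//] := bF i p cp; case: nF; exists i, q.
Qed.

Definition open_perm (A : set (kappa -> kappa)) :=
  forall h, bijective h -> A h -> exists q, [/\ cond q, extends h q
    & forall h', bijective h' -> extends h' q -> A h'].

Lemma baire_property_open A : open_perm A -> baire_property A.
Proof.
move=> oA p cp.
have [[h [hb hp Ah]]|nA] := pselect (exists h, [/\ bijective h, extends h p & A h]).
  have [q [cq hq qA]] := oA h hb Ah; left; exists (p `|` q); split=> //.
    exact: cond_setU (bij_inj hb) hp hq cp cq.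
  by apply: comeagerT => h' hb' /(extends_sub (@subsetUr _ _ _)); exact: qA.
by right; apply: comeagerT => h hb hp Ah; apply: nA; exists h.
Qed.

(** Otherwise [h] has a neighbourhood outside [A], and by Baire category some permutation in this
    neighbourhood that extends [p] lies in [A]. *)
Lemma comeager_closed p A h : cond p -> open_perm (~` A) -> comeager p A ->
  bijective h -> extends h p -> A h.
Proof.
move=> cp oA pA hb hp; apply/not_notP => nA.
have [q [cq hq qA]] := oA h hb nA.
have cpq := cond_setU (bij_inj hb) hp hq cp cq.
have [h' [hb' hpq Ah']] := comeager_nonempty cpq (comeager_ext (@subsetUl _ _ _) pA).
exact: qA hb' (extends_sub (@subsetUr _ _ _) hpq) Ah'.
Qed.

Definition image_cond (f : kappa -> kappa) (p : set (kappa * kappa)) :=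
  [set u | exists2 y, p (u.1, y) & u.2 = f y].

Lemma cond_image f p : injective f -> cond p -> cond (image_cond f p).
Proof.
move=> f_inj [[a pa] pf]; have [b fb] := regular a f.
have [c ac bc] := exists_gt2 a b; split.
  exists c => -[x _] [y /pa[/= xa ya] /= ->].
  by split; [exact: lt_trans ac|exact: lt_trans (fb _ ya) bc].
move=> [x w] [x' w'] [y /= pxy ->] [y' /= pxy' ->].
have [/= xy yx] := pf _ _ pxy pxy'.
by split=> [/xy ->//|/f_inj/yx].
Qed.

Lemma image_condK f g : cancel f g -> cancel (image_cond f) (image_cond g).
Proof.
move=> fK p; apply/seteqP; split=> -[x y] /=.
  by move=> [z [w pw /= ->] ->]; rewrite fK.
by move=> pxy; exists (f y); [exists y|rewrite fK].
Qed.

Lemma image_condS f p q : p `<=` q -> image_cond f p `<=` image_cond f q.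
Proof. by move=> pq u [y /pq]; exists y. Qed.

Lemma extends_image f h p : extends h p -> extends (f \o h) (image_cond f p).
Proof. by move=> hp [x y] [z /hp /= <- ->]. Qed.

(** Left translation by [f] is a homeomorphism of Sym(kappa), so the dense sets witnessing
    comeagerness are carried over by means of the inverse of [f]. *)
Lemma comeager_translate f p A : bijective f -> comeager p A ->
  comeager (image_cond f p) [set h | exists2 k, A k & bijective k /\ h = f \o k].
Proof.
move=> [g fK gK] [D [D_dense DA]].
have f_inj := can_inj fK; have g_inj := can_inj gK.
exists (fun i => [set q | D i (image_cond g q)]); split=> [i q cq|h hb hp hD].
  have [r [cr qr Dr]] := D_dense i _ (cond_image g_inj cq).
  exists (image_cond f r); split; first exact: cond_image.
    by rewrite -(image_condK gK q); exact: image_condS.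
  by rewrite /= (image_condK fK).
have hE : h = f \o (g \o h) by apply/funext => x /=; rewrite gK.
have ghb : bijective (g \o h) by apply: bij_comp => //; exists f.
exists (g \o h) => //; apply: DA => // [|i].
  by rewrite -(image_condK fK p); exact: extends_image.
have [q cq [Dq hq]] := hD i.
by exists (image_cond g q); [exact: cond_image|split=> //; exact: extends_image].
Qed.

End Cardinal.

(** * Closure properties of the Borel hierarchy *)

Section Borel.
Context (d : Order.disp_t) (kappa : orderType d).
Context (e : Order.disp_t) (W : orderType e).

Lemma ord_ge1_gt (b c : W) : c < b -> ord_ge1 b.
Proof. by exists c. Qed.

Lemma ord_ge2_gt (b c : W) : ord_ge1 c -> c < b -> ord_ge2 b.
Proof. by move=> c1 cb; exists c. Qed.

Lemma Sigma0_bigcup_onto (X : topologicalType) (I : Type) (b : W) (c : I -> W)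
    (F : I -> set X) : onto kappa I -> ord_ge2 b ->
  (forall i, ord_ge1 (c i)) -> (forall i, c i < b) ->
  (forall i, Sigma0 kappa (c i) (~` F i)) -> Sigma0 kappa b (\bigcup_i F i).
Proof.
move=> [f fP] b2 c1 cb cF.
have -> : \bigcup_i F i = \bigcup_k F (f k).
  apply/seteqP; split=> x [i _ Fx]; last by exists (f i).
  by have [k fk] := fP i; exists k; rewrite ?fk.
by apply: (Sigma0_bigcup (c := fun k => c (f k))) => // k; exact: cF.
Qed.

Lemma Sigma0_of_Pi0 (X : topologicalType) (b c : W) (S : set X) :
  inhabited kappa -> ord_ge1 c -> c < b -> Pi0 kappa c S -> Sigma0 kappa b S.
Proof.
move=> [k0] c1 cb cS.
have -> : S = \bigcup_(_ : kappa) S by apply/seteqP; split=> [x Sx|x [_ _]//]; exists k0.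
by apply: (Sigma0_bigcup (c := fun=> c)) => //; exact: ord_ge2_gt cb.
Qed.

Lemma Sigma0_preimage (X Y : topologicalType) (f : X -> Y) (b : W) (S : set Y) :
  (forall O, open O -> open (f @^-1` O)) -> Sigma0 kappa b S ->
  Sigma0 kappa b (f @^-1` S).
Proof.
move=> fO; elim=> {b S} [b S b1 oS|b c F b2 c1 cb _ IH].
  by apply: Sigma0_open => //; exact: fO.
by rewrite preimage_bigcup; exact: (Sigma0_bigcup (c := c)).
Qed.

End Borel.

(** * Vaught transforms *)

Section Vaught.
Context (d : Order.disp_t) (kappa : orderType d).
Context (kinf : infinite_cardinal kappa) (kpow : power_lt_eq kappa).
Context (e : Order.disp_t) (W : orderType e) (X : topologicalType).
Context (act : (kappa -> kappa) -> X -> X).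
Context (act_cont : forall h, bijective h ->
  forall O, open O -> open (act h @^-1` O)).
Context (act_open : forall x O, open O -> open_perm [set h | O (act h x)]).

Lemma Sigma0_baire (b : W) (S : set X) x :
  Sigma0 kappa b S -> baire_property [set h | S (act h x)].
Proof.
elim=> {b S} [b S _ /act_open oS|b c F _ _ _ _ IH].
  exact: (baire_property_open kinf).
have -> : [set h | (\bigcup_i F i) (act h x)] = \bigcup_i [set h | F i (act h x)] by [].
apply: (baire_property_bigcup kinf kpow) => i.
rewrite -[X in baire_property X]setCK.
exact: (baire_propertyC kinf kpow (IH i)).
Qed.

Definition vaught (S : set X) (p : set (kappa * kappa)) : set X :=
  [set x | comeager p [set h | S (act h x)]].

(** This is the dual transform: nonmeagerly many [h] extending [p] send the point into [S]. For open
    [S] one such [h] suffices. By the Baire property a union is nonmeager on [p] iff some [F i] is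
    comeager on an extension of [p], and the induction hypothesis for the complement of [F i] bounds
    the rank of that condition. *)
Lemma Sigma0_vaught (b : W) (S : set X) p : cond p -> Sigma0 kappa b S ->
  Sigma0 kappa b (~` vaught (~` S) p).
Proof.
move=> cp bS; elim: bS p cp => {b S} [b S b1 oS|b c F b2 c1 cb cF IH] p cp.
  apply: Sigma0_open => //.
  have -> : ~` vaught (~` S) p =
      \bigcup_(h in [set h | bijective h /\ extends h p]) act h @^-1` S.
    apply/seteqP; split=> x.
      move=> nx; apply/not_notP => nS; apply: nx; apply: comeagerT => //.
      by move=> h hb hp Sx; apply: nS; exists h.
    move=> [h [hb hp] Sx] xS.
    by apply: (comeager_closed kinf kpow cp _ xS hb hp Sx); rewrite setCK; exact: act_open.
  by apply: bigcup_open => h [hb _]; exact: act_cont.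
(* Every condition serves as an index: those not extending [p] are replaced by [p]. *)
pose q (r : condition kappa) := if pselect (p `<=` sval r) then sval r else p.
have cq r : cond (q r) by rewrite /q; case: pselect => [a|a] //=; exact: svalP.
have pq r : p `<=` q r by rewrite /q; case: pselect => [a|a] //=; exact: subset_refl.
have -> : ~` vaught (~` \bigcup_i F i) p =
    \bigcup_(ir : kappa * condition kappa) vaught (F ir.1) (q ir.2).
  apply/seteqP; split=> x; last first.
    move=> [[i r] _ /= xF] xS; apply: (comeager_consistent kinf kpow (cq r) (pq r) _ xS).
    by apply: comeager_sub xF => h _ _ Fh; exists i.
  move=> nx; apply/not_notP => nF; apply: nx.
  apply: (@comeager_sub _ _ _ (\bigcap_i [set h | (~` F i) (act h x)])).
    by move=> h _ _ hF [i _ Fi]; exact: hF i I Fi.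
  apply: (comeager_bigcap kinf kpow (onto_id kappa)) => i.
  have [[r [cr pr rF]]|] := baire_propertyC kinf kpow (Sigma0_baire x (cF i)) cp.
    case: nF; exists (i, exist _ r cr) => //; rewrite /q /=; case: pselect => //= _.
    by apply: comeager_sub rF => h _ _ /contrapT.
  by rewrite setCK.
apply: (Sigma0_bigcup_onto (c := fun ir => c ir.1)) => // [|ir].
  exact: (onto_prod kinf kpow (onto_id kappa) (onto_condition kinf kpow)).
rewrite -[F ir.1]setCK; exact: IH.
Qed.

(* In the application a point is a pair (M, N), [act] moves N only and [diag]
   sends (M, N) to (M, M). *)
Context (diag : X -> X) (diag_cont : forall O, open O -> open (diag @^-1` O)).

Lemma limit_Sigma0_Pi0 (alpha : W) (A : set X) : limit_ordinal alpha ->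
  (forall x h, bijective h -> A (act h (diag x))) ->
  (forall x h, bijective h -> A (act h x) -> A x) ->
  (forall x, A x -> exists2 f, bijective f &
    forall h, bijective h -> act (f \o h) x = act h (diag x)) ->
  Sigma0 kappa alpha A -> Pi0 kappa alpha A.
Proof.
move=> [[z za] alim] Adiag Ainv Atrans alphaA.
have [F [c [c1 ca cF AE]]] : exists F c, [/\ forall i, ord_ge1 (c i),
    forall i, c i < alpha, forall i : kappa, Sigma0 kappa (c i) (~` F i)
    & A = \bigcup_i F i].
  (* A limit ordinal is not 1, so [A] arises from the union clause. *)
  case: alphaA alim za => [b S [_ nb] _ blim zb|b c F _ c1 cb cF _ _].
    by have [c zc cb] := blim z zb; case: nb; apply: ord_ge2_gt cb; exact: ord_ge1_gt zc.
  by exists F, c.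
(* Two steps of room below the limit: the [None] member of [G] below is of class Pi^0 at rank
   [b1 i], and the union over [o] is of class Sigma^0 at rank [b2 i]. *)
have /choice[b1 b1P] : forall i, exists b, c i < b /\ b < alpha.
  by move=> i; have [b cb ba] := alim _ (ca i); exists b.
have /choice[b2 b2P] : forall i, exists b, b1 i < b /\ b < alpha.
  by move=> i; have [b cb ba] := alim _ (b1P i).2; exists b.
have FV i (p : condition kappa) : Sigma0 kappa (c i) (~` vaught (F i) (sval p)).
  by rewrite -[F i]setCK; apply: Sigma0_vaught (cF i); exact: svalP.
have b1_ge1 i : ord_ge1 (b1 i) by exact: ord_ge1_gt (b1P i).1.
(* The index [None] carries the failure of the clause on (M, M), so that both clauses describing [H]
   are negated in a single union. *)
pose G i (p : condition kappa) (o : option (condition kappa)) : set X :=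
  if o is Some q then vaught (F i) (sval q)
  else ~` (diag @^-1` vaught (F i) (sval p)).
pose H (ip : kappa * condition kappa) : set X := ~` \bigcup_o G ip.1 ip.2 o.
have vaught_sub i (p : condition kappa) x : vaught (F i) (sval p) x -> A x.
  move=> /(comeager_nonempty kinf kpow (svalP p))[h [hb _ Fh]].
  by apply: (Ainv x h hb); rewrite AE; exists i.
have -> : Pi0 kappa alpha A = Sigma0 kappa alpha (\bigcup_ip H ip).
  congr Sigma0; apply/seteqP; split=> x.
    move=> nA.
    (* Otherwise comeagerly many [h] avoid every [F i] at (M, M), and one such [h] contradicts
       [Adiag]. *)
    have [i [p Fp]] : exists i (p : condition kappa), vaught (F i) (sval p) (diag x).
      apply/not_notP => nF.
      have : comeager set0 (\bigcap_i [set h | ~ F i (act h (diag x))]).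
        apply: (comeager_bigcap kinf kpow (onto_id kappa)) => i.
        have := baire_propertyC kinf kpow (Sigma0_baire (diag x) (cF i)) (cond0 kinf).
        rewrite setCK => -[[q [cq _ qF]]|//]; case: nF; exists i, (exist _ q cq).
        by apply: comeager_sub qF => h _ _ /contrapT.
      move=> /(comeager_nonempty kinf kpow (cond0 kinf))[h [hb _ hF]].
      by have := Adiag x h hb; rewrite AE => -[i _]; exact: hF.
    exists (i, p) => // -[[q|] _ /=]; first by move=> /vaught_sub.
    exact.
  move=> [[i p] _ /= nG] Ax.
  have Fp : vaught (F i) (sval p) (diag x).
    by apply/not_notP => nF; apply: nG; exists None.
  have [f fb fE] := Atrans x Ax.
  (* The condition is translated by the isomorphism [f], since the composite of [f] and [k] moves
     (M, N) to where [k] moves (M, M). *)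
  apply: nG; exists (Some (exist _ _ (cond_image kinf kpow (bij_inj fb) (svalP p)))) => //=.
  apply: comeager_sub (comeager_translate kinf kpow fb Fp) => h _ _ /= [k Fk [kb ->]].
  by rewrite fE.
apply: (Sigma0_bigcup_onto (c := fun ip => b2 ip.1)) => [|||ip|ip].
- exact: (onto_prod kinf kpow (onto_id kappa) (onto_condition kinf kpow)).
- have [k0] := kappa_point kinf; exact: ord_ge2_gt (c1 k0) (ca k0).
- by move=> ip; exact: ord_ge1_gt (b2P ip.1).1.
- exact: (b2P ip.1).2.
rewrite /H setCK.
apply: (Sigma0_bigcup_onto
  (c := fun o => if o is Some _ then c ip.1 else b1 ip.1)) => [||[q|]|[q|]|[q|]] //=.
- exact: (onto_option kinf kpow (onto_condition kinf kpow)).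
- exact: ord_ge2_gt (b1_ge1 ip.1) (b2P ip.1).1.
- exact: lt_trans (b1P ip.1).1 (b2P ip.1).1.
- exact: (b2P ip.1).1.
rewrite setCK; apply: (Sigma0_of_Pi0 _ (c1 ip.1) (b1P ip.1).1).
  exact: kappa_point.
by apply: (Sigma0_preimage (f := diag)) (FV ip.1 ip.2).
Qed.

End Vaught.

(** * The space of structures *)

Section Structures.
Context (d : Order.disp_t) (kappa : orderType d) (L : language).
Implicit Types (M N : structure kappa L) (h : kappa -> kappa).

Lemma structure_ext M N :
  (forall s t, interp M (s := s) t <-> interp N t) -> M = N.
Proof.
case: M N => i [j] /= ij; congr Structure.
apply: functional_extensionality_dep => s; apply/seteqP.
by split=> t /ij.
Qed.

(* A right action, whence [pull_comp]. *)
Definition pull h M : structure kappa L :=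
  Structure (fun s => [set t | interp M (map_tuple h t)]).

Lemma pull_comp h k M : pull (h \o k) M = pull k (pull h M).
Proof.
apply: structure_ext => s t /=.
suff -> : map_tuple (h \o k) t = map_tuple h (map_tuple k t) by [].
by apply: val_inj; rewrite /= map_comp.
Qed.

Lemma isomorphicP M N : isomorphic M N <-> exists2 h, bijective h & M = pull h N.
Proof.
split=> -[h hb hMN]; exists h => //; first exact: structure_ext.
by rewrite hMN.
Qed.

Lemma isomorphic_pull h M : bijective h -> isomorphic M (pull h M).
Proof.
move=> [g hK gK]; apply/isomorphicP; exists g; first by exists h.
rewrite -pull_comp; apply: structure_ext => s t /=.
suff -> : map_tuple (h \o g) t = t by [].
by apply: val_inj => /=; rewrite (eq_map gK) map_id.
Qed.

(** For fixed [M] these are the neighbourhoods N_Q with [Q] the restriction of [M] to an initial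
    segment; they form a neighbourhood base at [M]. *)
Definition agree (b : kappa) M N := forall s (t : (arity s).-tuple kappa),
  (forall i, tnth t i < b) -> interp M t <-> interp N t.

Lemma agree_pull (a b : kappa) h M N : (forall x, x < a -> h x < b) ->
  agree b M N -> agree a (pull h M) (pull h N).
Proof.
move=> hab MN s t ta /=; apply: MN => i.
by rewrite tnth_map; exact/hab/ta.
Qed.

Lemma agree_le (a b : kappa) M N : a <= b -> agree b M N -> agree a M N.
Proof. by move=> ab MN s t ta; apply: MN => i; exact: lt_le_trans (ta i) ab. Qed.

Lemma agree_pull_eq (a : kappa) h k M : (forall x, x < a -> h x = k x) ->
  agree a (pull h M) (pull k M).
Proof.
move=> hk s t ta /=.
suff -> : map_tuple h t = map_tuple k t by [].
by apply: eq_from_tnth => i; rewrite !tnth_map hk.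
Qed.

Lemma open_agree (b : kappa) M : open [set N | agree b M N].
Proof.
pose Q : bounded_structure kappa L := @BoundedStructure _ _ _
  [set x | x < b] (ex_intro _ b (fun x xb => xb))
  (Structure (fun s => [set t | interp M (map_tuple set_val t)])).
have -> : [set N | agree b M N] = basic_open Q.
  apply/seteqP; split=> N MN s t.
    by apply: MN => i; rewrite tnth_map; exact: (set_valP (tnth t i)).
  move=> tb.
  pose t' : (arity s).-tuple (set_type [set x | x < b]) :=
    [tuple exist _ (tnth t i) (mem_set (tb i)) | i < arity s].
  have <- : map_tuple set_val t' = t.
    by apply: eq_from_tnth => i; rewrite tnth_map tnth_mktuple.
  exact: MN.
have oQ : finI_from (range (@basic_open _ kappa L)) id (basic_open Q).
  by apply: (finI_from1 id); exists Q.
exists [set basic_open Q]; first by move=> _ ->.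
by rewrite bigcup_set1.
Qed.

(** Finitely many bounded domains have a common bound. *)
Lemma finI_ex_agree (B : set (structure kappa L)) M :
  inhabited kappa -> finI_from (range (@basic_open _ kappa L)) id B -> B M ->
  exists b, forall N, agree b M N -> B N.
Proof.
move=> [k0] [E Erange <-] EM.
have agree_in A : A \in E -> exists b, forall N, agree b M N -> A N.
  move=> AE; have /set_mem[Q _ QA] := Erange _ AE.
  have [b Qb] := bdom_bounded Q.
  exists b => N MN; rewrite -QA => s t.
  have MQ : basic_open Q M by rewrite QA; exact: EM.
  rewrite MQ; apply: MN => i; rewrite tnth_map.
  exact/Qb/(set_valP (tnth t i)).
suff [b bE] : exists b, forall A, A \in (E : seq _) -> forall N, agree b M N -> A N.
  by exists b => N MN A AE; exact: (bE A AE N).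
have : forall A, A \in (E : seq _) -> A \in E by [].
elim: (E : seq _) => [|A s IH] sE; first by exists k0.
have [|b bs] := IH; first by move=> A' As; apply: sE; rewrite inE As orbT.
have [|a aA] := agree_in A; first by apply: sE; rewrite inE eqxx.
exists (Order.max a b) => A'; rewrite inE => /predU1P[->|As] N MN.
  by apply: aA; apply: agree_le MN; rewrite le_max lexx.
by apply: (bs _ As); apply: agree_le MN; rewrite le_max lexx orbT.
Qed.

Lemma open_ex_agree (S : set (structure kappa L)) M :
  inhabited kappa -> open S -> S M ->
  exists b, forall N, agree b M N -> S N.
Proof.
move=> k0 [D Dfin <-] [B DB BM].
have [b bB] := finI_ex_agree k0 (Dfin _ DB) BM.
by exists b => N /bB BN; exists B.
Qed.

Lemma open_prodP (K : set (structure kappa L)) (S : set (set_type K * set_type K)) :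
  inhabited kappa ->
  open S <-> forall x, S x -> exists b, forall y : set_type K * set_type K,
    agree b (set_val x.1) (set_val y.1) -> agree b (set_val x.2) (set_val y.2) -> S y.
Proof.
move=> k0.
have nbhsP (x : set_type K) A : nbhs x A <->
    exists b, forall y : set_type K, agree b (set_val x) (set_val y) -> A y.
  rewrite nbhsE; split=> [[_ [[O oO <-] Ox] OA]|[b bA]].
    have [b bO] := open_ex_agree k0 oO Ox.
    by exists b => y xy; apply: OA; exact: bO.
  exists [set y | agree b (set_val x) (set_val y)] => //; split=> //.
  by exists [set N | agree b (set_val x) N] => //; exact: open_agree.
split=> [oS x Sx|hS].
  have [[A B] [/= /nbhsP[a aA] /nbhsP[b bB]] AB] : nbhs x S by exact: open_nbhs_nbhs.
  exists (Order.max a b) => y xy1 xy2; apply: AB; split=> /=.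
    by apply: aA; apply: agree_le xy1; rewrite le_max lexx.
  by apply: bB; apply: agree_le xy2; rewrite le_max lexx orbT.
rewrite openE => x /hS[b bS].
exists ([set y | agree b (set_val x.1) (set_val y)],
        [set y | agree b (set_val x.2) (set_val y)]) => /=.
  by split; apply/nbhsP; exists b.
by move=> y [/= xy1 xy2]; exact: bS.
Qed.

End Structures.

(** * The action of Sym(kappa) on the second coordinate of pairs *)

Section Action.
Context (d : Order.disp_t) (kappa : orderType d) (L : language).
Context (kinf : infinite_cardinal kappa) (kpow : power_lt_eq kappa).
Context (K : set (structure kappa L)) (Kinv : invariant_set K).
Local Notation X := (set_type K * set_type K)%type.

(** The default [x.2] of [insubd] is never reached for bijective [h], because [K] is invariant. *)
Definition act2 (h : kappa -> kappa) (x : X) : X :=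
  (x.1, insubd x.2 (pull h (set_val x.2))).

Lemma act2E h x : bijective h ->
  set_val (act2 h x).2 = pull h (set_val x.2).
Proof.
move=> hb; apply: insubdK; apply/mem_set.
exact: Kinv (isomorphic_pull _ hb) (set_valP x.2).
Qed.

(** By regularity [h] maps the segment below [b] into one below some [c], so [N] below [c]
    determines [N.h] below [b]. *)
Lemma act2_cont h : bijective h -> forall O, open O -> open (act2 h @^-1` O).
Proof.
have k0 := kappa_point kinf.
move=> hb O /(open_prodP _ k0) oO; apply/(open_prodP _ k0) => x /oO[b bO].
have [c hc] := regular kinf kpow b h.
exists (Order.max b c) => y xy1 xy2; apply: bO => /=.
  by apply: agree_le xy1; rewrite le_max lexx.
rewrite !act2E //; apply: agree_pull hc _.
by apply: agree_le xy2; rewrite le_max lexx orbT.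
Qed.

(** For fixed [N], the part of [N.h] below [b] depends only on [h] below [b], whose graph is a
    condition. *)
Lemma act2_open x O : open O -> open_perm [set h | O (act2 h x)].
Proof.
have k0 := kappa_point kinf.
move=> /(open_prodP _ k0) oO h hb /oO[b bO].
exists [set u | u.1 < b /\ h u.1 = u.2]; split=> [|u []//|k kb hk].
  exact: cond_graph (bij_inj hb).
apply: bO => //; rewrite !act2E //.
by apply: agree_pull_eq => y yb; rewrite (hk (y, h y)).
Qed.

Definition diag2 (x : X) : X := (x.1, x.1).

Lemma diag2_cont O : open O -> open (diag2 @^-1` O).
Proof.
have k0 := kappa_point kinf.
move=> /(open_prodP _ k0) oO; apply/(open_prodP _ k0) => x /oO[b bO].
by exists b => y xy _; apply: bO.
Qed.

Lemma iso_rel_limit (e : Order.disp_t) (W : orderType e) (alpha : W) :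
  limit_ordinal alpha -> Sigma0 kappa alpha (iso_rel K) -> Pi0 kappa alpha (iso_rel K).
Proof.
move=> alim; apply: (limit_Sigma0_Pi0 kinf kpow act2_cont act2_open diag2_cont) => //.
- by move=> x h hb; rewrite /iso_rel /mkset act2E //; exact: isomorphic_pull.
- move=> x h hb; rewrite /iso_rel /mkset act2E // => /isomorphicP[k kb ->].
  by apply/isomorphicP; exists (h \o k); [exact: bij_comp|rewrite pull_comp].
move=> x /isomorphicP[f fb xE]; exists f => // h hb.
congr pair; apply: val_inj.
have fhE := act2E x (bij_comp fb hb); rewrite pull_comp -xE in fhE.
exact: etrans fhE (esym (act2E (diag2 x) hb)).
Qed.

End Action.

Theorem theorem6p1 (d : Order.disp_t) (kappa : orderType d) (L : language)
    (e : Order.disp_t) (W : orderType e) (alpha : W) :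
  infinite_cardinal kappa ->
  power_lt_eq kappa ->
  card_lt [set: symbol L] [set: kappa] ->
  well_order (<=%O : rel W) ->
  lt_succ_card kappa alpha ->
  limit_ordinal alpha ->
  ~ exists K : set (structure kappa L),
      invariant_set K /\ true_Sigma0 kappa alpha (iso_rel K).
Proof.
move=> kinf kpow _ _ _ alim [K [Kinv [KS]]]; apply.
exact: iso_rel_limit.
Qed.
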